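(* For every odd integer $n\geqslant 3$, there are infinitely many integral trees of diameter $2n+1$.
   Context: A graph is integral if all eigenvalues of its adjacency matrix are integers. *)

(* Defs.v *)
From HB Require Import structures.
From mathcomp Require Import all_boot all_order all_algebra all_field.
Set Implicit Arguments. Unset Strict Implicit. Unset Printing Implicit Defensive.
Import Order.TTheory GRing.Theory Num.Theory.

Definition simple_graph (T : finType) (e : rel T) : Prop :=
  symmetric e /\ irreflexive e.

Definition connected_graph (T : finType) (e : rel T) : Prop :=
  forall x y : T, connect e x y.

Definition acyclic_graph (T : finType) (e : rel T) : Prop :=
  forall c : seq T, ucycle e c -> size c < 3.

Definition is_tree (T : finType) (e : rel T) : Prop :=
  [/\ simple_graph e, 0 < #|T|, connected_graph e & acyclic_graph e].

Definition walk_len (T : finType) (e : rel T) (x y : T) (m : nat) : Prop :=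
  exists p : seq T, [/\ path e x p, last x p = y & size p = m].

Definition diameter_is (T : finType) (e : rel T) (D : nat) : Prop :=
  (forall x y : T, exists2 m, m <= D & walk_len e x y m) /\
  (exists x y : T, forall m, walk_len e x y m -> D <= m).

Definition adjmx (k : nat) (e : rel 'I_k) : 'M[algC]_k :=
  \matrix_(i < k, j < k) ((e i j)%:R : algC)%R.

Definition integral_graph (k : nat) (e : rel 'I_k) : Prop :=
  forall a : algC, eigenvalue (adjmx e) a -> (a \in Num.int)%R.

(* Main.v *)
(** Write D_T(x) = phi(T) / phi(T - root), phi being the characteristic
    polynomial.  Adding s as a new branch at the root of t gives
    D_t - 1 / D_s, so an eigenvalue of the tree obtained by joining the roots
    of T and T' is either a zero of D_s for some proper branch s, or a
    solution of D_T D_T' = 1.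

    In Csikvari's trees C_k, built from an increasing sequence s_0 < s_1 < ...,
    one has D_{C_k} D_{C_(k+1)} = z - s_k with z = x^2, so the branches are
    integral as soon as the s_i are squares.  Let b^2 + 1 = 2 c^2 (negative
    Pell equation).  T' is C_n for the sequence
    (b+2)^2, (b+4)^2, ..., (b+2(n-1))^2, 2 b^2.  T is the same as C_n for the
    sequence b^2 + 1, (b+2)^2, (b+4)^2, ..., except that the non-square b^2 + 1
    is realized as the average of (b-1)^2 and (b+1)^2, by taking half of the
    branches with either value, so that all branches remain integral.
    Everything cancels in the product:
    D_T D_T' = (z - b^2 - 1) (z - 2 b^2) / z, which is 1 exactly
    for z = b^2 and z = 2 b^2 + 2 = (2 c)^2. *)
Require Import Defs.
From HB Require Import structures.
From mathcomp Require Import all_boot all_order all_algebra all_field.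
From mathcomp Require Import zify ring.
Import GRing.Theory Num.Theory.

(** * Rooted trees as graphs *)

(* [Graft t s] hangs [s] as a new branch at the root of [t]. *)
Inductive rtree := Leaf | Graft (t s : rtree).

Fixpoint vert (t : rtree) : finType :=
  if t is Graft t1 t2 then (vert t1 + vert t2)%type else unit.

Fixpoint root (t : rtree) : vert t :=
  match t with Leaf => tt | Graft t1 t2 => inl (root t1) end.

Fixpoint adj (t : rtree) : rel (vert t) :=
  match t with
  | Leaf => fun _ _ => false
  | Graft t1 t2 => fun x y =>
      match x, y with
      | inl x, inl y => adj t1 x y
      | inr x, inr y => adj t2 x y
      | inl x, inr y => (x == root t1) && (y == root t2)
      | inr y, inl x => (x == root t1) && (y == root t2)
      end
  end.

Fixpoint depth (t : rtree) : vert t -> nat :=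
  match t with
  | Leaf => fun _ => 0
  | Graft t1 t2 => fun x =>
      match x with inl x => depth t1 x | inr y => (depth t2 y).+1 end
  end.

Fixpoint parent (t : rtree) : vert t -> vert t :=
  match t with
  | Leaf => fun x => x
  | Graft t1 t2 => fun x =>
      match x with
      | inl x => inl (parent t1 x)
      | inr y => if y == root t2 then inl (root t1) else inr (parent t2 y)
      end
  end.

Fixpoint height (t : rtree) : nat :=
  if t is Graft t1 t2 then maxn (height t1) (height t2).+1 else 0.

Lemma adj_sym t : symmetric (adj t).
Proof. by elim: t => //= t1 IH1 t2 IH2 [x|x] [y|y]. Qed.

Lemma adj_irr t : irreflexive (adj t).
Proof. by elim: t => //= t1 IH1 t2 IH2 [x|x]. Qed.

Lemma depth_root t : depth t (root t) = 0.
Proof. by elim: t. Qed.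

Lemma adj_depth {t} {x y : vert t} : adj t x y ->
  (depth t y = (depth t x).+1 /\ x = parent t y) \/
  (depth t x = (depth t y).+1 /\ y = parent t x).
Proof.
elim: t x y => [//|t1 IH1 t2 IH2] [x|x] [y|y] /=.
- by case/IH1=> -[-> ->]; [left|right].
- by case/andP=> /eqP-> /eqP->; rewrite eqxx !depth_root; left.
- by case/andP=> /eqP-> /eqP->; rewrite eqxx !depth_root; right.
case/IH2=> -[dE pE]; [left|right]; rewrite dE; split=> //;
  by case: eqP dE pE => [-> | _ _ <- //]; rewrite depth_root.
Qed.

Lemma walk_cat {T : finType} {e : rel T} {x y z m k} :
  walk_len e x y m -> walk_len e y z k -> walk_len e x z (m + k).
Proof.
move=> [p [pp lp sp]] [q [pq lq sq]]; exists (p ++ q).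
by rewrite cat_path pp last_cat size_cat sp sq lp.
Qed.

Lemma walk_rev {T : finType} {e : rel T} {x y m} : symmetric e ->
  walk_len e x y m -> walk_len e y x m.
Proof.
move=> esym [p [pp <- <-]]; exists (rev (belast x p)).
rewrite rev_path size_rev size_belast; split=> //.
  by rewrite (eq_path (e' := e)) // => u v; apply: esym.
by case: p pp => //= a p _; rewrite rev_cons last_rcons.
Qed.

Lemma walk_map {T U : finType} {e : rel T} {e' : rel U} {h : T -> U} {x y m} :
  {homo h : u v / e u v >-> e' u v} ->
  walk_len e x y m -> walk_len e' (h x) (h y) m.
Proof.
move=> he [p [pp <- <-]]; exists (map h p); rewrite last_map size_map.
by split=> //; rewrite path_map; apply: sub_path pp => u v /he.
Qed.

Lemma root_walk t (x : vert t) : walk_len (adj t) x (root t) (depth t x).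
Proof.
elim: t x => [[]|t1 IH1 t2 IH2 [x|y]] /=; first by exists [::].
  by apply: walk_map (IH1 x).
have to1 : walk_len (adj (Graft t1 t2)) (inr (root t2)) (inl (root t1)) 1.
  by exists [:: inl (root t1)]; rewrite /= !eqxx.
rewrite -addn1; apply: walk_cat to1.
by apply: walk_map (IH2 y).
Qed.

Lemma walk_via_root t (x y : vert t) :
  walk_len (adj t) x y (depth t x + depth t y).
Proof. exact: walk_cat (root_walk t x) (walk_rev (adj_sym t) (root_walk t y)). Qed.

(** Both cycle neighbours of a deepest vertex of the cycle must be its parent, so they coincide,
    against the distinctness of the vertices. *)
Lemma acyclic_adj t : acyclic_graph (adj t).
Proof.
move=> c cc; case: ltnP => // c3.
have [x xc xmax] : exists2 x, x \in c & forall y, y \in c -> depth t y <= depth t x.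
  case: c {cc} c3 => // x0 c _; have x0c : x0 \in x0 :: c by rewrite mem_head.
  by case: (@arg_maxnP _ x0 [in x0 :: c] (depth t) x0c) => x xc xm; exists x.
have [i c' cE] := rot_to xc.
have : ucycle (adj t) (rot i c) by rewrite rot_ucycle.
have : forall y, y \in rot i c -> depth t y <= depth t x.
  by move=> y; rewrite mem_rot => /xmax.
have : 2 < size (rot i c) by rewrite size_rot.
rewrite {}cE; case: c' => [//|y c']; case/lastP: c' => [//|c' z] _ le_x.
have yx : depth t y <= depth t x by rewrite le_x // !inE eqxx orbT.
have zx : depth t z <= depth t x by rewrite le_x // !inE mem_rcons mem_head !orbT.
case/andP=> /=; rewrite rcons_path last_rcons => /and3P[exy _ ezx].
have -> : y = parent t x by case: (adj_depth exy) => -[? ?] //; lia.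
have -> : z = parent t x by case: (adj_depth ezx) => -[? ?] //; lia.
by rewrite mem_rcons mem_head /= andbF.
Qed.

(** * Height and diameter *)

Lemma depth_le_height t (x : vert t) : depth t x <= height t.
Proof.
by elim: t x => //= t1 IH1 t2 IH2 [x|x]; rewrite leq_max ?IH1 // ltnS IH2 orbT.
Qed.

Lemma height_attained t : exists x, depth t x = height t.
Proof.
elim: t => [|t1 [x dx] t2 [y dy]] /=; first by exists tt.
by case: leqP => _; [exists (inr y) | exists (inl x)]; rewrite /= ?dy ?dx.
Qed.

Lemma connected_adj t : connected_graph (adj t).
Proof.
move=> x y; have [p [pp lp _]] := walk_via_root t x y.
by apply/connectP; exists p.
Qed.

Lemma adj_tree t : is_tree (adj t).
Proof.
split; [by split; [exact: adj_sym|exact: adj_irr]| |exact: connected_adj|].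
  by apply/card_gt0P; exists (root t).
exact: acyclic_adj.
Qed.

(** Walks through the roots give the upper bound; deepest vertices on the two sides attain it. *)
Lemma diameter_graft t1 t2 h : height t1 = h -> height t2 = h ->
  diameter_is (adj (Graft t1 t2)) (2 * h + 1).
Proof.
move=> h1 h2; split=> [x y|].
  have d1 (z : vert t1) : depth t1 z <= h by rewrite -h1 depth_le_height.
  have d2 (z : vert t2) : depth t2 z <= h by rewrite -h2 depth_le_height.
  case: x y => [x|x] [y|y]; last first.
  - exists (depth t2 x + depth t2 y); first by have := d2 x; have := d2 y; lia.
    by apply: walk_map (walk_via_root t2 x y).
  - exists (depth t2 x + depth t1 y).+1; first by have := d2 x; have := d1 y; lia.
    exact: walk_via_root (Graft t1 t2) (inr x) (inl y).
  - exists (depth t1 x + depth t2 y).+1; first by have := d1 x; have := d2 y; lia.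
    by rewrite -addnS; exact: walk_via_root (Graft t1 t2) (inl x) (inr y).
  - exists (depth t1 x + depth t1 y); first by have := d1 x; have := d1 y; lia.
    exact: walk_via_root (Graft t1 t2) (inl x) (inl y).
have [x dx] := height_attained t1; have [y dy] := height_attained t2.
exists (inl x), (inr y) => m [p [pp lp <-]].
(* [lev] changes by at most 1 along an edge. *)
pose lev (z : vert (Graft t1 t2)) : nat :=
  match z with inl z => h - depth t1 z | inr z => h.+1 + depth t2 z end.
have lev_path (z : vert (Graft t1 t2)) q : path (adj (Graft t1 t2)) z q ->
    lev (last z q) <= lev z + size q.
  elim: q z => [|w q IH] z; first by rewrite addn0.
  rewrite [path _ _ _]/=; case/andP=> zw /IH /= le_w.
  suff : lev w <= (lev z).+1 by move: le_w; lia.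
  move: zw {le_w}; case: z w => [z|z] [w|w] /=.
  - by case/adj_depth=> -[-> _]; lia.
  - by case/andP=> /eqP-> /eqP->; rewrite !depth_root; lia.
  - by case/andP=> /eqP-> /eqP->; rewrite !depth_root; lia.
  - by case/adj_depth=> -[-> _]; lia.
have := lev_path _ _ pp; rewrite lp /= dx dy h1 h2; lia.
Qed.

(** * Eigenvectors and branch ratios *)

Section Eigenvectors.
Local Open Scope ring_scope.
Variables (F : fieldType) (lam : F).

(* [den t] is the value at [lam] of phi(t) / phi(t - root). *)
Fixpoint den (t : rtree) : F :=
  if t is Graft t1 t2 then den t1 - (den t2)^-1 else lam.

(** Rules out the default value [0^-1 = 0] in [den]: [lam] is a zero of [den] for no proper
    branch. *)
Fixpoint regular (t : rtree) : bool :=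
  if t is Graft t1 t2 then [&& regular t1, regular t2 & den t2 != 0] else true.

Lemma sum_adj_inl t1 t2 (f : vert (Graft t1 t2) -> F) x :
  \sum_(y | adj (Graft t1 t2) (inl x) y) f y =
  \sum_(y | adj t1 x y) f (inl y) + (x == root t1)%:R * f (inr (root t2)).
Proof.
rewrite big_sumType /=; congr (_ + _); case: eqP => _ /=.
  by rewrite mul1r big_pred1_eq.
by rewrite mul0r big_pred0.
Qed.

Lemma sum_adj_inr t1 t2 (f : vert (Graft t1 t2) -> F) x :
  \sum_(y | adj (Graft t1 t2) (inr x) y) f y =
  (x == root t2)%:R * f (inl (root t1)) + \sum_(y | adj t2 x y) f (inr y).
Proof.
rewrite big_sumType /=; congr (_ + _); case: eqP => _ /=.
  by rewrite mul1r (eq_bigl (pred1 (root t1))) ?big_pred1_eq // => y; rewrite andbT.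
by rewrite mul0r big_pred0 // => y; rewrite andbF.
Qed.

(** Leaving the root free lets the induction apply to both parts of a graft. The equation at the
    root of [t2] reads [den t2 * f (root t2) = f (root t1)]; as [den t2] is nonzero, vanishing at
    the root spreads down the branch. *)
Lemma regular_root t (f : vert t -> F) : regular t ->
    (forall x, x != root t -> lam * f x = \sum_(y | adj t x y) f y) ->
  lam * f (root t) - \sum_(y | adj t (root t) y) f y = den t * f (root t) /\
  (f (root t) = 0 -> forall x, f x = 0).
Proof.
elim: t f => [|t1 IH1 t2 IH2] f /=.
  move=> _ _; rewrite big_pred0 // subr0; split=> // f0 x.
  by case: x.
case/and3P=> reg1 reg2 den2 harm.
have [|D1 z1] := IH1 (f \o inl) reg1.
  move=> x xr; have := harm (inl x); rewrite sum_adj_inl (negPf xr) mul0r addr0; exact.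
have [|D2 z2] := IH2 (f \o inr) reg2.
  move=> x xr; have := harm (inr x); rewrite sum_adj_inr (negPf xr) mul0r add0r; exact.
have root2 : den t2 * f (inr (root t2)) = f (inl (root t1)).
  have := harm (inr (root t2)); rewrite sum_adj_inr eqxx mul1r => /(_ isT) e.
  by rewrite -D2 /= e addrK.
split=> [|f0].
  rewrite sum_adj_inl eqxx mul1r opprD addrA [X in X - _ = _]D1 /= -root2.
  by field.
have f20 : f (inr (root t2)) = 0.
  by move/eqP: root2; rewrite f0 mulf_eq0 (negPf den2) /= => /eqP.
by case=> [x|x]; [apply: (z1 f0) | apply: (z2 f20)].
Qed.

(** With root values [a1] and [a2], the equations at the two roots are [den t1 * a1 = a2] and
    [den t2 * a2 = a1], hence [(den t1 * den t2 - 1) * a1 = 0]. *)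
Lemma graft_no_eigenvector t1 t2 (f : vert (Graft t1 t2) -> F) :
    regular t1 -> regular t2 -> den t1 * den t2 != 1 ->
    (forall x, lam * f x = \sum_(y | adj (Graft t1 t2) x y) f y) ->
  forall x, f x = 0.
Proof.
move=> reg1 reg2 den12 harm.
have [|D1 z1] := regular_root _ (f \o inl) reg1.
  by move=> x xr; rewrite /= harm sum_adj_inl (negPf xr) mul0r addr0.
have [|D2 z2] := regular_root _ (f \o inr) reg2.
  by move=> x xr; rewrite /= harm sum_adj_inr (negPf xr) mul0r add0r.
have e1 : den t1 * f (inl (root t1)) = f (inr (root t2)).
  by rewrite -D1 /= harm sum_adj_inl eqxx mul1r addrAC subrr add0r.
have e2 : den t2 * f (inr (root t2)) = f (inl (root t1)).
  by rewrite -D2 /= harm sum_adj_inr eqxx mul1r addrK.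
have f10 : f (inl (root t1)) = 0.
  apply/eqP; move: den12; rewrite -subr_eq0; apply: contraNT => f1.
  by rewrite -(inj_eq (mulIf f1)) mul0r mulrBl mul1r mulrAC e1 mulrC e2 subrr.
have f20 : f (inr (root t2)) = 0 by rewrite -e1 f10 mulr0.
by case=> [x|x]; [apply: (z1 f10) | apply: (z2 f20)].
Qed.
End Eigenvectors.

Arguments den {F} lam t.
Arguments regular {F} lam t.

(** * Csikvari's trees: height and size *)

Definition grafts (t s : rtree) (m : nat) : rtree := iter m (Graft^~ s) t.

(* Csikvari's tree [T(r_1, ..., r_k)] with [s i = r_k + ... + r_(k-i)]. *)
Fixpoint csik (s : nat -> nat) (k : nat) : rtree :=
  match k with
  | 0 => Leaf
  | k1.+1 =>
      match k1 with
      | 0 => grafts Leaf Leaf (s 0)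
      | k2.+1 => grafts (csik s k2) (csik s k1) (s k1 - s k2)
      end
  end.

(* [csik] of odd depth, with the branches taken half from [s1], half from [s2];
   used for sequences that differ only at 0. *)
Fixpoint mixed (s1 s2 : nat -> nat) (j : nat) : rtree :=
  match j with
  | 0 => grafts Leaf Leaf (s1 0 + s2 0)./2
  | i.+1 =>
      let m := (s1 i.*2.+2 - s1 i.*2.+1)./2 in
      grafts (grafts (mixed s1 s2 i) (csik s1 i.*2.+2) m) (csik s2 i.*2.+2) m
  end.

Lemma csikSS s k :
  csik s k.+2 = grafts (csik s k) (csik s k.+1) (s k.+1 - s k).
Proof. by []. Qed.

Lemma mixedS s1 s2 j (m := (s1 j.*2.+2 - s1 j.*2.+1)./2) :
  mixed s1 s2 j.+1 =
    grafts (grafts (mixed s1 s2 j) (csik s1 j.*2.+2) m) (csik s2 j.*2.+2) m.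
Proof. by []. Qed.

Lemma height_grafts t s m : 0 < m ->
  height (grafts t s m) = maxn (height t) (height s).+1.
Proof.
case: m => // m _; elim: m => [//|m IH].
by rewrite -[LHS]/(maxn (height (grafts t s m.+1)) (height s).+1) IH -maxnA maxnn.
Qed.

(** Strict growth of [s] makes every branch multiplicity positive, so each level is really
    present. *)
Lemma height_csik s k : 0 < s 0 -> {homo s : i j / i < j} -> height (csik s k) = k.
Proof.
move=> s0 smono.
suff : height (csik s k) = k /\ height (csik s k.+1) = k.+1 by case.
elim: k => [|k [IH1 IH2]]; first by rewrite /= height_grafts.
split=> //; rewrite csikSS height_grafts ?subn_gt0 ?smono //.
by rewrite IH1 IH2; apply/maxn_idPr; lia.
Qed.

Lemma height_mixed s1 s2 j : 0 < s1 0 -> 0 < s2 0 ->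
    {homo s1 : i j / i < j} -> {homo s2 : i j / i < j} ->
    (forall i, 1 < s1 i.*2.+2 - s1 i.*2.+1) ->
  height (mixed s1 s2 j) = j.*2.+1.
Proof.
move=> s10 s20 mono1 mono2 gap; elim: j => [|j IH].
  by rewrite /= height_grafts // half_gt0; lia.
have m0 : 0 < (s1 j.*2.+2 - s1 j.*2.+1)./2 by rewrite half_gt0.
by rewrite mixedS !(height_grafts _ _ _ m0) IH !height_csik //; lia.
Qed.

Lemma card_grafts t s m : m <= #|vert (grafts t s m)|.
Proof.
elim: m => //= m IH; rewrite card_sum -addn1 leq_add //.
by apply/card_gt0P; exists (root s).
Qed.

Lemma card_mixed s1 s2 j : (s1 0 + s2 0)./2 <= #|vert (mixed s1 s2 j)|.
Proof.
have card_le t s m : #|vert t| <= #|vert (grafts t s m)|.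
  by elim: m => //= m /leq_trans; apply; rewrite card_sum leq_addr.
elim: j => [|j IH]; first exact: card_grafts.
by apply: leq_trans IH _; apply: leq_trans (card_le _ _ _); apply: card_le.
Qed.

(** * Branch ratios of Csikvari's trees *)

Section Denominators.
Local Open Scope ring_scope.
Variables (F : numFieldType) (lam : F).
Hypothesis lam0 : lam != 0.
Local Notation den := (den lam).
Local Notation regular := (regular lam).

Lemma den_grafts t s m : den (grafts t s m) = den t - m%:R / den s.
Proof.
elim: m => [|m IH] /=; first by rewrite mul0r subr0.
by rewrite [den _]IH -[m.+1]addn1 natrD mulrDl mul1r opprD addrA.
Qed.

Lemma regular_grafts t s m :
  regular t -> regular s -> den s != 0 -> regular (grafts t s m).
Proof. by move=> rt rs ds; elim: m => //= m ->; rewrite rs. Qed.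

(** Multiplying the recursion for [den (csik s k.+2)] by [den (csik s k.+1)] makes the products of
    neighbours telescope. A nonzero product at one stage gives the nonzero ratio at the next. *)
Lemma csik_step (s : nat -> nat) K k : {homo s : i j / (i < j)%N} ->
    (forall i, (i < K)%N -> lam ^+ 2 != (s i)%:R) -> (k <= K)%N ->
  [/\ den (csik s k) != 0, regular (csik s k), regular (csik s k.+1) &
      den (csik s k) * den (csik s k.+1) = lam ^+ 2 - (s k)%:R].
Proof.
move=> smono ns; elim: k => [|k IH] lekK.
  split=> //; first by apply: regular_grafts.
  by rewrite [csik s 1]/= den_grafts /=; field.
have [d0 r0 r1 e] := IH (ltnW lekK).
have d1 : den (csik s k.+1) != 0.
  have : den (csik s k) * den (csik s k.+1) != 0 by rewrite e subr_eq0 ns.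
  by rewrite mulf_eq0 negb_or => /andP[].
split=> //; first by apply: regular_grafts.
rewrite csikSS den_grafts natrB; last by rewrite ltnW ?smono.
rewrite mulrBr mulrCA mulfV // mulr1 mulrC e; ring.
Qed.

(** Passing from [j] to [j.+1] multiplies both ratios by the same factor,
    [(z - s (2j+2)) / (z - s (2j+1))] with [z = lam ^+ 2], since [s'] is [s] shifted by one. *)
Lemma csik_shift (s s' : nat -> nat) K j :
    {homo s : i j / (i < j)%N} -> {homo s' : i j / (i < j)%N} ->
    (forall i, (i < K)%N -> s' i = s i.+1) ->
    (forall i, (i <= K)%N -> lam ^+ 2 != (s i)%:R) -> (j.*2 <= K)%N ->
  lam ^+ 2 * den (csik s j.*2.+1) =
    (lam ^+ 2 - (s 0%N)%:R) * den (csik s' j.*2).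
Proof.
move=> smono smono' ss' ns; elim: j => [|j IH] lejK.
  by rewrite [csik s _]/= den_grafts /=; field.
have ns' i : (i < K)%N -> lam ^+ 2 != (s' i)%:R by move=> iK; rewrite ss' ?ns.
have step k := @csik_step s K.+1 k smono ns.
have step' k := @csik_step s' K k smono' ns'.
rewrite doubleS in lejK; have {IH} := IH ltac:(lia).
rewrite doubleS; move: (j.*2) lejK => i iK IH.
have [_ _ _ A] := step i.+1 ltac:(lia).
have [Y0 _ _ B] := step i.+2 ltac:(lia).
have [_ _ _ A'] := step' i ltac:(lia).
have [Y0' _ _ B'] := step' i.+1 ltac:(lia).
rewrite !ss' in A' B'; try lia.
have A0 : lam ^+ 2 - (s i.+1)%:R != 0 by rewrite subr_eq0 ns //; lia.
(* [X], [Y], [Z] stand for three consecutive ratios of [s], the primed letters for those of [s'];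
   [a] and [b] are the shared products of neighbours. *)
have cancel (z c a b X X' Y Z Y' Z' : F) : a != 0 -> Y != 0 -> Y' != 0 ->
    z * X = c * X' -> X * Y = a -> Y * Z = b -> X' * Y' = a -> Y' * Z' = b ->
    z * Z = c * Z'.
  move=> a0 ? ? e {}A {}B {}A' {}B'.
  have {e} e : z * Y' = c * Y.
    apply: (mulfI a0); rewrite -{1}A -A'.
    by transitivity (z * X * Y * Y'); [ring | rewrite e; ring].
  apply: (@mulfI _ Y) => //; apply: (@mulfI _ Y') => //.
  transitivity (z * Y' * (Y * Z)); first by ring.
  by rewrite e B -B'; ring.
exact: cancel A0 Y0 Y0' IH A B A' B'.
Qed.

(** By [den_grafts], the ratio is affine in the branch multiplicities, so taking half of the
    branches from each sequence averages the two ratios; the parity hypotheses make the halves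
    exact. *)
Lemma den_mixed (s1 s2 : nat -> nat) K j :
    {homo s1 : i j / (i < j)%N} -> {homo s2 : i j / (i < j)%N} ->
    (forall i, (i < K)%N -> lam ^+ 2 != (s1 i)%:R) ->
    (forall i, (i < K)%N -> lam ^+ 2 != (s2 i)%:R) ->
    (forall i, (0 < i)%N -> s1 i = s2 i) -> ~~ odd (s1 0 + s2 0)%N ->
    (forall i, ~~ odd (s1 i.*2.+2 - s1 i.*2.+1)%N) -> (j.*2 <= K)%N ->
  regular (mixed s1 s2 j) /\
  den (mixed s1 s2 j) *+ 2 = den (csik s1 j.*2.+1) + den (csik s2 j.*2.+1).
Proof.
move=> mono1 mono2 ns1 ns2 s12 even0 even_gap.
have half_sum m : ~~ odd m -> m%:R = m./2%:R *+ 2 :> F.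
  by move=> em; rewrite -mulrnA muln2 even_halfK.
elim: j => [|j IH] lejK.
  split; first by apply: regular_grafts.
  rewrite [mixed _ _ _]/= [csik s1 _]/= [csik s2 _]/= !den_grafts.
  by rewrite mulrnBl -mulrnAl -half_sum // natrD; ring.
rewrite doubleS in lejK; have [reg e] := IH ltac:(lia).
have [d1 r1 _ _] := csik_step s1 K j.*2.+2 mono1 ns1 lejK.
have [d2 r2 _ _] := csik_step s2 K j.*2.+2 mono2 ns2 lejK.
rewrite mixedS doubleS; split.
  by apply: regular_grafts => //; apply: regular_grafts.
rewrite (csikSS s1 j.*2.+1) (csikSS s2 j.*2.+1) -(s12 j.*2.+2) // -(s12 j.*2.+1) //.
rewrite (den_grafts (csik s1 _)) (den_grafts (csik s2 _)).
rewrite (den_grafts (grafts _ _ _)) (den_grafts (mixed _ _ _)).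
by rewrite (half_sum _ (even_gap j)) !mulrnBl e; ring.
Qed.
End Denominators.

Arguments csik_step {F lam}.
Arguments csik_shift {F lam}.
Arguments den_mixed {F lam}.

(** * The sequences of squares and the product of the two ratios *)

(** The first root [t] is kept free for the values [b.-1] and [b.+1]; the later roots share the
    parity of [b], so that their gaps can be halved. *)
Definition base_squares (b t k : nat) : nat :=
  if k is 0 then t ^ 2 else (b + k.*2) ^ 2.

(* Only the terms up to index [K] matter; the rest keeps the sequence increasing. *)
Definition shifted_squares (b K k : nat) : nat :=
  if k < K then (b + k.+1.*2) ^ 2 else 2 * b ^ 2 + (k - K).

Lemma homo_ltn_succ (s : nat -> nat) :
  (forall i, s i < s i.+1) -> {homo s : i j / i < j}.
Proof. by move=> h; apply: homo_ltn h => x y z; apply: ltn_trans. Qed.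

Lemma base_squares_mono b t : t < b.+2 -> {homo base_squares b t : i j / i < j}.
Proof.
by move=> tb; apply: homo_ltn_succ => -[|i]; rewrite ltn_sqr //; lia.
Qed.

Lemma shifted_squares_mono b K : 5 * K <= b -> 0 < b ->
  {homo shifted_squares b K : i j / i < j}.
Proof.
move=> Kb b0; apply: homo_ltn_succ => i; rewrite /shifted_squares.
have [iK|iK] := ltnP i K; have [i1K|i1K] := ltnP i.+1 K; try lia.
(* At the junction [i.+1 = K], the last square stays below [2 * b ^ 2] because
   [(7/5)^2 = 49/25 < 2]. *)
have : 5 * (b + i.+1.*2) <= 7 * b by lia.
by rewrite -leq_sqr !expnMn; lia.
Qed.

Definition left_tree (b j : nat) : rtree :=
  mixed (base_squares b b.-1) (base_squares b b.+1) j.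

Definition right_tree (b j : nat) : rtree :=
  csik (shifted_squares b j.*2) j.*2.+1.

Lemma den_joint (lam : algC) b c j : b ^ 2 + 1 = 2 * c ^ 2 -> 10 * j < b ->
    (forall m : nat, lam ^+ 2 != (m ^ 2)%:R)%R ->
  [/\ regular lam (left_tree b j), regular lam (right_tree b j) &
      (den lam (left_tree b j) * den lam (right_tree b j) != 1)%R].
Proof.
move=> bc jb nsq; rewrite /left_tree /right_tree.
have lam0 : lam != 0%R by have := nsq 0; rewrite expf_eq0.
set s1 := base_squares b b.-1; set s2 := base_squares b b.+1.
set s' := shifted_squares b j.*2.
have mono1 : {homo s1 : i j / i < j} by apply: base_squares_mono; lia.
have mono2 : {homo s2 : i j / i < j} by apply: base_squares_mono; lia.
have mono' : {homo s' : i j / i < j} by apply: shifted_squares_mono; lia.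
have ns1 i : (lam ^+ 2 != (s1 i)%:R)%R by case: i => [|i]; apply: nsq.
have ns2 i : (lam ^+ 2 != (s2 i)%:R)%R by case: i => [|i]; apply: nsq.
have ns' i : i < j.*2 -> (lam ^+ 2 != (s' i)%:R)%R.
  by move=> ij; rewrite /s' /shifted_squares ij; apply: nsq.
have s1' i : i < j.*2 -> s' i = s1 i.+1 by rewrite /s' /shifted_squares => ->.
have s2' i : i < j.*2 -> s' i = s2 i.+1 by rewrite /s' /shifted_squares => ->.
have [|||reg1 e] := den_mixed lam0 s1 s2 j.*2 j mono1 mono2
  (fun i _ => ns1 i) (fun i _ => ns2 i) _ _ _ (leqnn _).
- by case.
- have b1 : b.+1 = b.-1.+2 by lia.
  by rewrite /s2 b1 oddD !oddX /= negbK addbb.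
- move=> i; rewrite oddB; last by rewrite ltnW ?mono1.
  by rewrite !oddX !oddD !odd_double addbb.
have [d' _ reg2 e'] := csik_step lam0 s' j.*2 j.*2 mono' ns' (leqnn _).
split=> //.
have := csik_shift lam0 s1 s' j.*2 j mono1 mono' s1' (fun i _ => ns1 i) (leqnn _).
have := csik_shift lam0 s2 s' j.*2 j mono2 mono' s2' (fun i _ => ns2 i) (leqnn _).
have s'E : ((s' j.*2)%:R = (b ^ 2)%:R *+ 2 :> algC)%R.
  by rewrite /s' /shifted_squares ltnn subnn addn0 natrM mulr_natl.
have s0E : ((s1 0%N)%:R = ((b ^ 2)%:R + 1) *+ 2 - (s2 0%N)%:R :> algC)%R.
  apply/eqP; rewrite eq_sym subr_eq natr1 -natrD -mulrnA eqr_nat /=.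
  by case: (b) jb => // b' _; apply/eqP; rewrite /=; lia.
move: {bc} (congr1 (GRing.natmul (1%R : algC)) bc) e e' s0E; rewrite s'E.
(* [b] and [2 * c] are the square roots of the two values of [z] at which the product is 1. *)
have := nsq b; have := nsq (2 * c); rewrite expnMn.
move: (lam ^+ 2)%R => z nsq_c nsq_b bc.
move: (den lam (mixed _ _ _)) (den lam (csik s' _.+1)) => P Q.
move: (den lam (csik s' _)) (den lam (csik s1 _)) (den lam (csik s2 _)) => X U V.
move: (s1 0)%:R%R (s2 0)%:R%R => u v e e' uv eV eU.
apply/eqP => PQ.
have : ((z - (b ^ 2)%:R) * (z - (2 ^ 2 * c ^ 2)%:R) = 0)%R.
  have -> : ((2 ^ 2 * c ^ 2)%:R = ((b ^ 2)%:R + 1) *+ 2 :> algC)%R.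
    by rewrite (_ : 2 ^ 2 = 2 * 2) // -mulnA natrM -bc natrD mulr_natl.
  (* [P * Q = 1] becomes [z = (z - b^2 - 1) * (z - 2 b^2)], doubled since [e] describes only
     [P *+ 2]: the shift identities turn [U] and [V] into multiples of [X], and
     [X * Q = z - 2 b^2]. *)
  have two : (z *+ 2 = ((z - (b ^ 2)%:R - 1) * (z - (b ^ 2)%:R *+ 2)) *+ 2)%R.
    transitivity (z * (P *+ 2) * Q)%R; first by rewrite -[LHS]mulr1 -PQ; ring.
    by rewrite e mulrDr eU eV uv -e'; ring.
  have : (2%:R : algC)%R != 0%R by rewrite pnatr_eq0.
  move/mulfI; apply; move/eqP: two; rewrite eq_sym -subr_eq0 => /eqP two0.
  by rewrite mulr0 -[RHS]two0; ring.
by move/eqP; rewrite mulf_eq0 !subr_eq0 (negPf nsq_b) (negPf nsq_c).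
Qed.

(** * Transfer to graphs on ordinals *)

Definition ord_graph {T : finType} (e : rel T) : rel 'I_#|T| :=
  fun i j => e (enum_val i) (enum_val j).

Lemma walk_ord_graph {T : finType} (e : rel T) i j m :
  walk_len (ord_graph e) i j m <-> walk_len e (enum_val i) (enum_val j) m.
Proof.
split; first by apply: walk_map.
rewrite -{2}(enum_valK i) -{2}(enum_valK j); apply: walk_map => u v.
by rewrite /ord_graph !enum_rankK.
Qed.

Lemma diameter_ord_graph {T : finType} (e : rel T) d :
  diameter_is e d -> diameter_is (ord_graph e) d.
Proof.
move=> [le_d [x [y ge_d]]]; split=> [i j|].
  have [m md w] := le_d (enum_val i) (enum_val j).
  by exists m => //; apply/walk_ord_graph.
exists (enum_rank x), (enum_rank y) => m /walk_ord_graph.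
by rewrite !enum_rankK; apply: ge_d.
Qed.

Lemma tree_ord_graph {T : finType} (e : rel T) :
  is_tree e -> is_tree (ord_graph e).
Proof.
case=> [[esym eirr] T0 conn acyc]; split; first split.
- by move=> i j; apply: esym.
- by move=> i; apply: eirr.
- by rewrite card_ord.
- move=> i j; have /connectP[p pp lp] := conn (enum_val i) (enum_val j).
  have [|q [pq lq _]] := (walk_ord_graph e i j (size p)).2; first by exists p.
  by apply/connectP; exists q.
move=> c /andP[cc uc]; rewrite -(size_map enum_val); apply: acyc.
by rewrite /ucycle (map_inj_uniq enum_val_inj) uc cycle_map cc.
Qed.

(** [eigenvalue] concerns row vectors, so symmetry of [e] is what turns the product with the matrix
    into a sum over neighbours. *)
Lemma integral_ord_graph {T : finType} (e : rel T) : symmetric e ->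
    (forall (lam : algC) (f : T -> algC), lam \notin Num.int ->
      (forall x, lam * f x = \sum_(y | e x y) f y)%R -> forall x, f x = 0%R) ->
  integral_graph (ord_graph e).
Proof.
move=> esym noeig lam /eigenvalueP[v Av v0]; apply: contraNT v0 => /noeig vanish.
apply/eqP/rowP => i; rewrite mxE -[i]enum_valK.
apply: (vanish (fun x => v 0%R (enum_rank x))) => x.
have := congr1 (fun w : 'rV_ _ => w 0%R (enum_rank x)) Av; rewrite !mxE => <-.
rewrite [RHS]big_mkcond (reindex_onto enum_rank enum_val) /=; last first.
  by move=> j _; apply: enum_valK.
apply: eq_big => [y|y _]; first by rewrite enum_rankK eqxx.
by rewrite mxE /ord_graph !enum_rankK esym mulr_natr; case: (e x y).
Qed.

Lemma nonint_sqr (lam : algC) (m : nat) :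
  (lam \notin Num.int -> lam ^+ 2 != (m ^ 2)%:R)%R.
Proof.
apply: contraNneq => /eqP; rewrite natrX eqf_sqr => /orP[]/eqP->.
  by rewrite rpred_nat.
by rewrite rpredN rpred_nat.
Qed.

(** * Pell solutions and the conclusion *)

Lemma negative_pell M : exists b c, M < b /\ b ^ 2 + 1 = 2 * c ^ 2.
Proof.
elim: M => [|M [b [c [Mb e]]]]; first by exists 1, 1.
(* Multiplication of [b + c sqrt 2] by the unit [3 + 2 sqrt 2] of norm 1. *)
by exists (3 * b + 4 * c), (2 * b + 3 * c); split; lia.
Qed.

Theorem theorem6 (n : nat) : odd n -> 3 <= n ->
  forall N : nat, exists (k : nat) (e : rel 'I_k),
    [/\ N <= k, is_tree e, integral_graph e & diameter_is e (2 * n + 1)].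
Proof.
move=> n_odd n3 N; have nE : n = n./2.*2.+1 by lia.
(* [N] serves the vertex count, [10 * n] the growth of the shifted sequence. *)
have [b [c [Nb bc]]] := negative_pell (N + 10 * n).
set j := n./2 in nE; have jb : 10 * j < b by lia.
pose t := Graft (left_tree b j) (right_tree b j).
exists #|vert t|, (ord_graph (adj t)); split.
- rewrite card_sum (leq_trans _ (leq_addr _ _)) //.
  (* The initial star alone has [((b-1)^2 + (b+1)^2) / 2 = b^2 + 1] leaves. *)
  apply: leq_trans (card_mixed _ _ _); rewrite /=; nia.
- exact/tree_ord_graph/adj_tree.
- apply: integral_ord_graph (adj_sym t) _ => lam f nlam.
  have [r1 r2 d] := den_joint lam b c j bc jb (fun m => nonint_sqr lam m nlam).
  exact: graft_no_eigenvector.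
have gap i : 1 < base_squares b b.-1 i.*2.+2 - base_squares b b.-1 i.*2.+1.
  rewrite /=; nia.
apply: diameter_ord_graph; apply: diameter_graft.
  rewrite height_mixed //=; try (apply: base_squares_mono); lia.
rewrite height_csik //.
  by rewrite /shifted_squares; case: ifP => _; nia.
by apply: shifted_squares_mono; lia.
Qed.
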